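(* Let $R$ be an arbitrary (associative and commutative) radically Noetherian domain containing the field of rational numbers $\mathbb{Q}=\mathbb{Q}\cdot 1\subseteq R$, and let $m\ge1$. Then the Poisson algebra $P_m$ over $R$ is equationally Noetherian.
   Context: $R$ has identity; it is radically Noetherian if it satisfies the ascending chain condition on radical (radically closed) ideals. $P_m$ (the symplectic Poisson algebra of index $m$ over $R$) is the polynomial algebra $R[x_1,\ldots,x_{2m}]$ with its usual multiplication and the bracket $$\{f,g\}=\sum_{i=1}^m\Bigl(\frac{\partial f}{\partial x_{2i-1}}\frac{\partial g}{\partial x_{2i}}-\frac{\partial f}{\partial x_{2i}}\frac{\partial g}{\partial x_{2i-1}}\Bigr).$$ Equationally Noetherian: let $A$ be a Poisson algebra over $R$ and $\mathfrak{M}$ a variety of Poisson algebras over $R$ with $A\in\mathfrak{M}$. For $k\ge 1$ let $\mathfrak{M}\langle z_1,\ldots,z_k\rangle$ be the free algebra of $\mathfrak{M}$ on $z_1,\ldots,z_k$, and let $D=A\sqcup_{\mathfrak{M}}\mathfrak{M}\langle z_1,\ldots,z_k\rangle$ be the coproduct in $\mathfrak{M}$ (only varieties for which both canonical maps into $D$ are injective are considered). For $f\in D$ and $(a_1,\ldots,a_k)\in A^k$ put $f(a_1,\ldots,a_k)=\phi(f)$, where $\phi:D\to A$ is the unique homomorphism that is the identity on $A$ and sends $z_i$ to $a_i$. For $S\subseteq D$ put $Z(S)=\{a\in A^k : f(a)=0 \text{ for all } f\in S\}$. The sets $Z(S)$ define (as a subbasis of closed sets) the Zariski topology on $A^k$.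 $A$ is equationally Noetherian if $A^k$ is a Noetherian topological space for every $k\ge1$; equivalently, for every $k$ and every $S\subseteq D$ there is a finite $S_0\subseteq S$ with $Z(S)=Z(S_0)$. This does not depend on the choice of $\mathfrak{M}$ containing $A$ (one may take the variety generated by $A$). *)

(* Defs.v *)
From HB Require Import structures.
From mathcomp Require Import all_boot all_order all_algebra.
From mathcomp Require Import ring.
From mathcomp Require Import mpoly.

Set Implicit Arguments.
Unset Strict Implicit.
Unset Printing Implicit Defensive.

Import GRing.Theory.
Local Open Scope ring_scope.

(* Ideals and arbitrary subsets are [Prop]-valued predicates, so that no
   decidability is imposed on them. *)
Definition is_radical_ideal (R : comNzRingType) (I : R -> Prop) : Prop :=
  [/\ I 0,
      forall x y, I x -> I y -> I (x + y),
      forall a x, I x -> I (a * x)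
    & forall x n, I (x ^+ n.+1) -> I x].

Definition radically_noetherian (R : comNzRingType) : Prop :=
  forall I : nat -> R -> Prop,
    (forall n, is_radical_ideal (I n)) ->
    (forall n x, I n x -> I n.+1 x) ->
    exists N, forall n, (N <= n)%N -> forall x, I n x <-> I N x.

(* Poisson algebras are unital.  [comAlgType] also excludes the zero algebra;
   being terminal, it has no effect on the universal properties below. *)
HB.mixin Record isPoisson (R : comNzRingType) P of GRing.ComAlgebra R P := {
  pbr : P -> P -> P;
  pbr_linearl : forall z, linear (pbr^~ z);
  pbr_linearr : forall z, linear (pbr z);
  pbrxx : forall x, pbr x x = 0;
  pbr_jacobi : forall x y z,
    pbr x (pbr y z) + pbr y (pbr z x) + pbr z (pbr x y) = 0;
  pbr_leibniz : forall x y z, pbr (x * y) z = x * pbr y z + pbr x z * y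
}.

#[short(type="poissonAlgType")]
HB.structure Definition Poisson (R : comNzRingType) :=
  {P of GRing.ComAlgebra R P & isPoisson R P}.

Section PoissonAlgebras.

Variable R : comNzRingType.
Implicit Types (A B D F : poissonAlgType R) (k : nat).

Definition poisson_morphism A B (f : A -> B) : Prop :=
  [/\ linear f, monoid_morphism f & {morph f : x y / pbr x y}].

Definition unique_morphism A B (P : (A -> B) -> Prop) : Prop :=
  exists2 f, poisson_morphism f /\ P f
           & forall g, poisson_morphism g /\ P g -> g =1 f.

Inductive pterm : Type :=
  | PVar of nat
  | POne
  | PAdd of pterm & pterm
  | PScale of R & pterm
  | PMul of pterm & pterm
  | PBr of pterm & pterm.

Fixpoint peval A (v : nat -> A) (t : pterm) : A :=
  match t with
  | PVar i => v i
  | POne => 1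
  | PAdd s u => peval v s + peval v u
  | PScale c s => c *: peval v s
  | PMul s u => peval v s * peval v u
  | PBr s u => pbr (peval v s) (peval v u)
  end.

(* A variety is the class of all algebras satisfying a set of identities
   [t = 0]; it is represented by that set. *)
Definition variety := pterm -> Prop.

Definition in_variety (M : variety) A : Prop :=
  forall t, M t -> forall v : nat -> A, peval v t = 0.

Definition is_free (M : variety) k F (z : 'I_k -> F) : Prop :=
  in_variety M F /\
  forall B, in_variety M B -> forall b : 'I_k -> B,
    unique_morphism (fun f : F -> B => forall i, f (z i) = b i).

Definition is_coproduct (M : variety) A F D (iA : A -> D) (iF : F -> D)
    : Prop :=
  [/\ in_variety M D, poisson_morphism iA, poisson_morphism iF &
      forall B, in_variety M B ->
      forall (f : A -> B) (g : F -> B),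
        poisson_morphism f -> poisson_morphism g ->
        unique_morphism
          (fun h : D -> B => (forall x, h (iA x) = f x) /\
                             (forall y, h (iF y) = g y))].

(* [phi] is the homomorphism [D -> A] which is the identity on [A] and sends
   the generators to [a]; it exists and is unique when [A] lies in the variety
   and [D] is the coproduct. *)
Definition is_evaluation k A F D (z : 'I_k -> F) (iA : A -> D) (iF : F -> D)
    (a : {ffun 'I_k -> A}) (phi : D -> A) : Prop :=
  [/\ poisson_morphism phi, forall x, phi (iA x) = x
    & forall i, phi (iF (z i)) = a i].

Definition zero_set k A F D (z : 'I_k -> F) (iA : A -> D) (iF : F -> D)
    (S : D -> Prop) (a : {ffun 'I_k -> A}) : Prop :=
  exists2 phi, is_evaluation z iA iF a phi & forall f, S f -> phi f = 0.

End PoissonAlgebras.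

(* The closed sets of the topology on [X] for which the family [B] is a
   subbasis of closed sets.  The last constructor makes the notion invariant
   under extensional equality of subsets. *)
Inductive generated_closed (X : Type) (B : (X -> Prop) -> Prop) :
    (X -> Prop) -> Prop :=
  | closed_subbasis C : B C -> generated_closed B C
  | closed_empty : generated_closed B (fun _ => False)
  | closed_union C1 C2 : generated_closed B C1 -> generated_closed B C2 ->
      generated_closed B (fun x => C1 x \/ C2 x)
  | closed_inter (G : (X -> Prop) -> Prop) :
      (forall C, G C -> generated_closed B C) ->
      generated_closed B (fun x => forall C, G C -> C x)
  | closed_ext C1 C2 : (forall x, C1 x <-> C2 x) ->
      generated_closed B C1 -> generated_closed B C2.

Definition noetherian_space (X : Type) (closed : (X -> Prop) -> Prop) : Prop :=
  forall C : nat -> X -> Prop,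
    (forall n, closed (C n)) ->
    (forall n x, C n.+1 x -> C n x) ->
    exists N, forall n, (N <= n)%N -> forall x, C n x <-> C N x.

Definition zariski_closed (R : comNzRingType) k (A F D : poissonAlgType R)
    (z : 'I_k -> F) (iA : A -> D) (iF : F -> D)
    : ({ffun 'I_k -> A} -> Prop) -> Prop :=
  generated_closed (fun C => exists S : D -> Prop, C = zero_set z iA iF S).

Definition equationally_noetherian (R : comNzRingType) (A : poissonAlgType R)
    : Prop :=
  forall M : variety R, in_variety M A ->
  forall k, (0 < k)%N ->
  forall (F : poissonAlgType R) (z : 'I_k -> F), is_free M z ->
  forall (D : poissonAlgType R) (iA : A -> D) (iF : F -> D),
    is_coproduct M iA iF -> injective iA -> injective iF ->
    noetherian_space (zariski_closed z iA iF).

Definition symplectic (m : nat) (R : comNzRingType) : Type := {mpoly R[m.*2]}.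

HB.instance Definition _ m (R : comNzRingType) :=
  GRing.ComAlgebra.on (symplectic m R).

Section Symplectic.

Variables (m : nat) (R : comNzRingType).
Implicit Types (f g h : {mpoly R[m.*2]}) (i j : 'I_m).

Lemma sympl_odd_subproof i : (i.*2 < m.*2)%N.
Proof. by rewrite ltn_double. Qed.

Lemma sympl_even_subproof i : (i.*2.+1 < m.*2)%N.
Proof. by rewrite ltn_Sdouble. Qed.

(* Variables are numbered from 0: for the 1-based index i + 1, these are the
   positions of x_(2(i+1)-1) and x_(2(i+1)). *)
Definition xodd i : 'I_(m.*2) := Ordinal (sympl_odd_subproof i).
Definition xeven i : 'I_(m.*2) := Ordinal (sympl_even_subproof i).

Definition sympl_bracket f g : {mpoly R[m.*2]} :=
  \sum_(i < m) (f^`M(xodd i) * g^`M(xeven i) - f^`M(xeven i) * g^`M(xodd i)).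

Lemma sympl_linearl h : linear (sympl_bracket^~ h).
Proof.
move=> c f g; rewrite /sympl_bracket scaler_sumr -big_split /=.
apply: eq_bigr => i _; rewrite !mderivD !mderivZ scalerBr !mulrDl -!scalerAl.
by rewrite opprD addrACA.
Qed.

Lemma sympl_anti f g : sympl_bracket f g = - sympl_bracket g f.
Proof.
rewrite /sympl_bracket -sumrN; apply: eq_bigr => i _.
by rewrite opprB [X in X - _]mulrC [X in _ - X]mulrC.
Qed.

Lemma sympl_linearr h : linear (sympl_bracket h).
Proof.
move=> c f g; rewrite sympl_anti sympl_linearl opprD -scalerN.
by rewrite -!(sympl_anti h).
Qed.

Lemma symplxx f : sympl_bracket f f = 0.
Proof. by rewrite /sympl_bracket big1 // => i _; rewrite mulrC subrr. Qed.

Lemma sympl_leibniz f g h :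
  sympl_bracket (f * g) h = f * sympl_bracket g h + sympl_bracket f h * g.
Proof.
rewrite /sympl_bracket mulr_sumr mulr_suml -big_split /=.
by apply: eq_bigr => i _; rewrite !mderivM; ring.
Qed.

Let T1 f g h i j :=
  f^`M(xodd i) *
    (g^`M(xodd j)^`M(xeven i) * h^`M(xeven j)
     - g^`M(xeven j)^`M(xeven i) * h^`M(xodd j))
  - f^`M(xeven i) *
    (g^`M(xodd j)^`M(xodd i) * h^`M(xeven j)
     - g^`M(xeven j)^`M(xodd i) * h^`M(xodd j)).

Let T2 f g h i j :=
  f^`M(xodd i) *
    (g^`M(xodd j) * h^`M(xeven j)^`M(xeven i)
     - g^`M(xeven j) * h^`M(xodd j)^`M(xeven i))
  - f^`M(xeven i) *
    (g^`M(xodd j) * h^`M(xeven j)^`M(xodd i)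
     - g^`M(xeven j) * h^`M(xodd j)^`M(xodd i)).

Let T1T2 f g h :
  \sum_i \sum_j T1 g h f i j = - \sum_i \sum_j T2 f g h i j.
Proof.
rewrite exchange_big -sumrN; apply: eq_bigr => i _ /=.
rewrite -sumrN; apply: eq_bigr => j _; rewrite /T1 /T2.
rewrite !(mderiv_comm _ (xodd i)) !(mderiv_comm _ (xeven i)).
rewrite ?(mderiv_comm (xodd j) (xeven i)) ?(mderiv_comm (xeven j) (xodd i)).
ring.
Qed.

Let bracket2 f g h : sympl_bracket f (sympl_bracket g h) =
  \sum_i \sum_j T1 f g h i j + \sum_i \sum_j T2 f g h i j.
Proof.
rewrite {1}/sympl_bracket -big_split /=; apply: eq_bigr => i _.
rewrite /sympl_bracket !linear_sum /= !mulr_sumr -sumrB -big_split /=.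
apply: eq_bigr => j _; rewrite /T1 /T2 !mderivB !mderivM; ring.
Qed.

Lemma sympl_jacobi f g h :
  sympl_bracket f (sympl_bracket g h) + sympl_bracket g (sympl_bracket h f)
  + sympl_bracket h (sympl_bracket f g) = 0.
Proof.
rewrite !bracket2 (T1T2 f g h) (T1T2 g h f) (T1T2 h f g); ring.
Qed.

HB.instance Definition _ := isPoisson.Build R (symplectic m R)
  sympl_linearl sympl_linearr symplxx sympl_jacobi sympl_leibniz.

End Symplectic.

(* Main.v *)
Require Import Defs.
From HB Require Import structures.
From mathcomp Require Import all_boot all_order all_algebra.
From mathcomp Require Import ring mpoly.
From mathcomp.classical Require Import boolp classical_sets filter.

Set Implicit Arguments.
Unset Strict Implicit.
Unset Printing Implicit Defensive.

Import GRing.Theory.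
Local Open Scope ring_scope.

(* Evaluating an element of the coproduct at a tuple [a] of polynomials gives a
   polynomial in the partial derivatives of the components of [a], so it is
   enough to prove a form of the Ritt-Raudenbush basis theorem.  If a descending
   chain of closed sets [C n] does not stabilize, choose points [y n] in [C n]
   and differential polynomials vanishing on a later closed set but not at
   [y n].  An ultrafilter refining the sequence [y] turns it into a generic point
   with values in a domain: [f] vanishes there iff it vanishes on a set of the
   ultrafilter.  Order the derivatives by a ranking and call one a leader if it
   is algebraic at the generic point over the preceding ones.  By Dickson's lemma
   finitely many leaders generate all leaders by differentiation.  Take their
   minimal relations; almost all [y n] satisfy these finitely many equations, but
   kill neither the initials nor the separants.  At such a point every [f]
   vanishing at the generic point vanishes, by induction on the highest
   derivative in [f]: if it is not a leader all coefficients vanish generically;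
   if it is a generating leader use pseudo-division; if it is a proper derivative
   of one, eliminate it with the differentiated relation, which is linear in it
   with the separant as coefficient.  This contradicts the choice of [y n]. *)

(** * Generators of a coproduct of Poisson algebras *)

(** Taking c = -1 in [generated_lin] yields zero, and then negatives. *)
Inductive generated (R : comNzRingType) (D : poissonAlgType R)
    (X : D -> Prop) : D -> Prop :=
  | generated_gen d : X d -> generated X d
  | generated_one : generated X 1
  | generated_lin c d e :
      generated X d -> generated X e -> generated X (c *: d + e)
  | generated_mul d e : generated X d -> generated X e -> generated X (d * e)
  | generated_br d e : generated X d -> generated X e -> generated X (pbr d e).

Section Sub.
Variables (R : comNzRingType) (D : poissonAlgType R) (X : D -> Prop).
Definition in_generated : {pred D} := fun d => `[< generated X d >].
Lemma in_generated_closed : subalg_closed in_generated.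
Proof.
split.
- exact/asboolP/generated_one.
- by move=> c d e /asboolP hd /asboolP he; apply/asboolP/generated_lin.
- by move=> d e /asboolP hd /asboolP he; apply/asboolP/generated_mul.
Qed.
HB.instance Definition _ :=
  GRing.isSubalgClosed.Build R D in_generated in_generated_closed.
Definition gensub := {d : D | in_generated d}.
HB.instance Definition _ := [isSub of gensub for @sval D in_generated].
HB.instance Definition _ := [Choice of gensub by <:].
HB.instance Definition _ := [SubChoice_isSubComNzRing of gensub by <:].
HB.instance Definition _ := [SubZmodule_isSubLmodule of gensub by <:].
HB.instance Definition _ :=
  [SubNzRing_SubLmodule_isSubLalgebra of gensub by <:].
HB.instance Definition _ := [SubLalgebra_isSubAlgebra of gensub by <:].

Lemma gensub_br_subproof (d e : gensub) : in_generated (pbr (val d) (val e)).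
Proof.
by case: d e => d Xd [e Xe]; apply/asboolP/generated_br; apply/asboolP.
Qed.

Definition gensub_br (d e : gensub) : gensub :=
  Sub _ (gensub_br_subproof d e).

Lemma val_gensub_br d e : val (gensub_br d e) = pbr (val d) (val e).
Proof. exact: SubK. Qed.

Lemma gensub_br_linearl z : linear (gensub_br^~ z).
Proof.
move=> c x y; apply: val_inj.
by rewrite linearP !val_gensub_br linearP pbr_linearl.
Qed.

Lemma gensub_br_linearr z : linear (gensub_br z).
Proof.
move=> c x y; apply: val_inj.
by rewrite linearP !val_gensub_br linearP pbr_linearr.
Qed.

Lemma gensub_brxx x : gensub_br x x = 0.
Proof. by apply: val_inj; rewrite val_gensub_br pbrxx raddf0. Qed.

Lemma gensub_br_jacobi x y z :
  gensub_br x (gensub_br y z) + gensub_br y (gensub_br z x)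
  + gensub_br z (gensub_br x y) = 0.
Proof. by apply: val_inj; rewrite !raddfD raddf0 /= pbr_jacobi. Qed.

Lemma gensub_br_leibniz x y z :
  gensub_br (x * y) z = x * gensub_br y z + gensub_br x z * y.
Proof.
by apply: val_inj; exact: pbr_leibniz.
Qed.

HB.instance Definition _ := isPoisson.Build R gensub gensub_br_linearl
  gensub_br_linearr gensub_brxx gensub_br_jacobi gensub_br_leibniz.

Lemma val_gensub_morphism : poisson_morphism (val : gensub -> D).
Proof.
by split; [exact: linearP | split; [exact: rmorph1 | exact: rmorphM] | ].
Qed.

End Sub.

Section Morphisms.
Variable R : comNzRingType.
Implicit Types (A B C D F : poissonAlgType R) (M : variety R).

Lemma peval_morphism A B (f : A -> B) (v : nat -> A) t :
  poisson_morphism f -> f (peval v t) = peval (f \o v) t.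
Proof.
case=> fL [f1 fM] fB.
have f0 : f 0 = 0 by have:= fL (-1) 0 0; rewrite !scaleN1r !addNr.
elim: t => //= [s <- u <-|c s <-|s <- u <-|s <- u <-].
- by have:= fL 1 (peval v s) (peval v u); rewrite !scale1r.
- by have:= fL c (peval v s) 0; rewrite f0 !addr0.
- exact: fM.
- exact: fB.
Qed.

Lemma in_variety_gensub M D (X : D -> Prop) :
  in_variety M D -> in_variety M (gensub X).
Proof.
move=> MD t Mt v; apply: val_inj; rewrite raddf0.
by rewrite (peval_morphism _ _ (val_gensub_morphism X)) MD.
Qed.

Lemma poisson_morphism_comp A B C (f : B -> C) (g : A -> B) :
  poisson_morphism f -> poisson_morphism g -> poisson_morphism (f \o g).
Proof.
move=> [fL [f1 fM] fB] [gL [g1 gM] gB]; split=> [c x y||x y] /=.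
- by rewrite gL fL.
- by split=> [|x y] /=; rewrite ?g1 ?f1 ?gM ?fM.
- by rewrite gB fB.
Qed.

Lemma poisson_morphism_id A : poisson_morphism (@id A).
Proof. by split; [move=> c x y | split=> [|x y] | move=> x y]. Qed.

Lemma unique_morphism_eq A B (P : (A -> B) -> Prop) (f g : A -> B) :
  unique_morphism P -> poisson_morphism f -> P f -> poisson_morphism g -> P g ->
  f =1 g.
Proof. by move=> [h _ hU] fm Pf gm Pg x; rewrite (hU f) // (hU g). Qed.

(* The subalgebra of [D] generated by [A] and the [z i] receives a morphism
   from [D], which must be a section of the inclusion. *)
Lemma coproduct_generated M A k F (z : 'I_k -> F) D (iA : A -> D) (iF : F -> D) :
  is_free M z -> is_coproduct M iA iF ->
  forall d, generated (fun e => (exists x, e = iA x) \/ exists i, e = iF (z i)) d.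
Proof.
move=> [MF freeF] [MD iAm iFm coD]; set X := (X in generated X).
pose E : poissonAlgType R := gensub X.
have ME : in_variety M E by exact: in_variety_gensub.
have vm : poisson_morphism (val : E -> D) := val_gensub_morphism X.
have XA x : in_generated X (iA x) by apply/asboolP/generated_gen; left; exists x.
have XF i : in_generated X (iF (z i)).
  by apply/asboolP/generated_gen; right; exists i.
pose jA x : E := Sub (iA x) (XA x).
have jAm : poisson_morphism jA.
  case: iAm => iL [i1 iM] iB; split=> [c x y||x y].
  - by apply: val_inj; rewrite linearP /= iL.
  - by split=> [|x y]; apply: val_inj; rewrite ?rmorph1 ?rmorphM /= ?i1 ?iM.
  - by apply: val_inj; rewrite val_gensub_br /= iB.
have [jF [jFm jFz] _] := freeF E ME (fun i => Sub (iF (z i)) (XF i)).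
(* Both sides are morphisms from the free algebra that agree on its generators. *)
have jFE y : val (jF y) = iF y.
  apply: (unique_morphism_eq (freeF D MD (iF \o z))
    (poisson_morphism_comp vm jFm) _ iFm) => // i.
  by rewrite /= jFz.
have [h [hm [hA hF]] _] := coD E ME jA jF jAm jFm.
(* [val \o h] is an endomorphism of [D] compatible with [iA] and [iF], hence the identity. *)
have hK d : val (h d) = d.
  apply: (unique_morphism_eq (coD D MD iA iF iAm iFm)
    (poisson_morphism_comp vm hm) _ (poisson_morphism_id D)) => //.
  by split=> x /=; rewrite ?hA ?hF ?jFE.
by move=> d; rewrite -[d]hK; case: (h d) => e Xe; apply/asboolP.
Qed.

(** [zero_set] asks for an evaluation to exist; knowing that it does, a point outside the set is one
    where some member of [S] takes a nonzero value. *)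
Lemma evaluation_exists M A k F (z : 'I_k -> F) D (iA : A -> D) (iF : F -> D) :
  in_variety M A -> is_free M z -> is_coproduct M iA iF ->
  forall a, exists phi, is_evaluation z iA iF a phi.
Proof.
move=> MA [MF freeF] [MD iAm iFm coD] a.
have [g [gm gz] _] := freeF A MA a.
have [h [hm [hA hF]] _] := coD A MA id g (poisson_morphism_id A) gm.
by exists h; split=> // i; rewrite hF gz.
Qed.

End Morphisms.

(** * Differential polynomials and generic points *)

Section DifferentialPolynomials.

Variables (P : idomainType) (I : Type) (V : eqType) (Y : Type).
Variables (delta : I -> P -> P) (idx : V -> nat) (s : I -> V -> V).
Variable u : V -> Y -> P.

Hypothesis pchar0 : forall n, n.+1%:R != 0 :> P.
Hypothesis deltaD : forall i, {morph delta i : x y / x + y}.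
Hypothesis deltaM :
  forall i x y, delta i (x * y) = delta i x * y + x * delta i y.
Hypothesis idx_inj : injective idx.
Hypothesis idx_lt : forall i v, (idx v < idx (s i v))%N.
Hypothesis idx_mono :
  forall i v w, (idx v < idx w)%N -> (idx (s i v) < idx (s i w))%N.
Hypothesis delta_u : forall i v y, delta i (u v y) = u (s i v) y.

(** Differential polynomials are taken as functions on the points [Y], with [u v y] the derivative
    [v] at [y]; [dpoly_ext] allows pointwise rewriting. Only variables of rank below [N] occur. *)
Inductive dpoly (N : nat) : (Y -> P) -> Prop :=
  | dpoly_ext f g : f =1 g -> dpoly N f -> dpoly N g
  | dpoly_const c : dpoly N (fun=> c)
  | dpoly_var v : (idx v < N)%N -> dpoly N (u v)
  | dpoly_add f g : dpoly N f -> dpoly N g -> dpoly N (fun y => f y + g y)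
  | dpoly_mul f g : dpoly N f -> dpoly N g -> dpoly N (fun y => f y * g y).

Lemma dpoly_le N M f : (N <= M)%N -> dpoly N f -> dpoly M f.
Proof.
move=> leNM; elim=> {f}.
- by move=> f g fg _; exact: dpoly_ext.
- by move=> c; exact: dpoly_const.
- by move=> v vN; apply: dpoly_var; exact: leq_trans leNM.
- by move=> f g _ ? _ ?; exact: dpoly_add.
- by move=> f g _ ? _ ?; exact: dpoly_mul.
Qed.

Lemma dpoly_opp N f : dpoly N f -> dpoly N (fun y => - f y).
Proof.
move=> Nf; apply: (@dpoly_ext N (fun y => (fun=> -1) y * f y)).
  by move=> y; rewrite mulN1r.
by apply: dpoly_mul => //; exact: dpoly_const.
Qed.

Lemma dpoly_exp N f n : dpoly N f -> dpoly N (fun y => f y ^+ n).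
Proof.
move=> Nf; elim: n => [|n IH].
  apply: (@dpoly_ext N (fun=> 1)) (dpoly_const _ _) => y.
  by rewrite expr0.
apply: dpoly_ext (dpoly_mul Nf IH) => y.
by rewrite exprS.
Qed.

Lemma dpoly0 f : dpoly 0 f -> exists c, f =1 fun=> c.
Proof.
elim=> {f} //.
- by move=> f g fg _ [c fc]; exists c => y; rewrite -fg fc.
- by move=> c; exists c.
- by move=> f g _ [c fc] _ [d gd]; exists (c + d) => y; rewrite fc gd.
- by move=> f g _ [c fc] _ [d gd]; exists (c * d) => y; rewrite fc gd.
Qed.

Lemma dpoly_delta N M i f : (N <= M)%N ->
  (forall v, idx v < N -> idx (s i v) < M)%N ->
  dpoly N f -> dpoly M (fun y => delta i (f y)).
Proof.
move=> leNM sNM; elim=> {f}.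
- by move=> f g fg _; apply: dpoly_ext => y; rewrite fg.
- by move=> c; exact: (dpoly_const _ (delta i c)).
- move=> v vN; apply: dpoly_ext (dpoly_var (sNM v vN)) => y.
  by rewrite delta_u.
- move=> f g _ IHf _ IHg; apply: dpoly_ext (dpoly_add IHf IHg) => y.
  by rewrite deltaD.
- move=> f g Nf IHf Ng IHg.
  apply: dpoly_ext (dpoly_add (dpoly_mul IHf (dpoly_le leNM Ng))
    (dpoly_mul (dpoly_le leNM Nf) IHg)) => y.
  by rewrite deltaM.
Qed.

(* Polynomials in [u v] of degree less than [e] whose coefficients only involve
   the variables preceding [v]. *)
Fixpoint upoly v e (f : Y -> P) : Prop :=
  if e is e'.+1 then
    exists c g, [/\ dpoly (idx v) c, upoly v e' g
                  & forall y, f y = c y * u v y ^+ e' + g y]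
  else forall y, f y = 0.

Lemma upoly_ext v e f g : f =1 g -> upoly v e f -> upoly v e g.
Proof.
move=> fg; case: e => [f0 y|e [c [h [vc eh fE]]]]; first by rewrite -fg f0.
by exists c, h; split=> // y; rewrite -fg.
Qed.

Lemma upoly_dpoly v e f : upoly v e f -> dpoly (idx v).+1 f.
Proof.
elim: e f => [f f0|e IH f [c [g [vc eg fE]]]].
  by apply: dpoly_ext (dpoly_const _ 0) => y; rewrite f0.
have vu : dpoly (idx v).+1 (u v) by exact: dpoly_var.
apply: dpoly_ext (dpoly_add (dpoly_mul (dpoly_le (leqnSn _) vc)
  (dpoly_exp e vu)) (IH g eg)) => y.
by rewrite fE.
Qed.

Lemma upolyS v e f : upoly v e f -> upoly v e.+1 f.
Proof.
move=> ef; exists (fun=> 0), f; split=> // [|y]; first exact: dpoly_const.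
by rewrite mul0r add0r.
Qed.

Lemma upoly_le v d e f : (d <= e)%N -> upoly v d f -> upoly v e f.
Proof.
by move=> /subnKC <- df; elim: (e - d)%N => [|n IH]; rewrite ?addn0 // addnS;
  exact: upolyS.
Qed.

Lemma upoly_add v e f g :
  upoly v e f -> upoly v e g -> upoly v e (fun y => f y + g y).
Proof.
elim: e f g => [f g f0 g0 y|e IH f g [c [f' [vc ef' fE]]] [d [g' [vd eg' gE]]]].
  by rewrite f0 g0 addr0.
exists (fun y => c y + d y), (fun y => f' y + g' y).
split; [exact: dpoly_add | exact: IH | move=> y].
by rewrite fE gE; ring.
Qed.

Lemma upoly_mulc v e c f :
  dpoly (idx v) c -> upoly v e f -> upoly v e (fun y => c y * f y).
Proof.
move=> vc; elim: e f => [f f0 y|e IH f [d [g [vd eg fE]]]].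
  by rewrite f0 mulr0.
exists (fun y => c y * d y), (fun y => c y * g y).
split; [exact: dpoly_mul | exact: IH | move=> y].
by rewrite fE; ring.
Qed.

Lemma upoly_mulX v e n f :
  upoly v e f -> upoly v (n + e) (fun y => u v y ^+ n * f y).
Proof.
elim: e f => [f f0|e IH f [c [g [vc eg fE]]]].
  by apply: (@upoly_le _ 0) => // y; rewrite f0 mulr0.
rewrite addnS; exists c, (fun y => u v y ^+ n * g y).
by split=> // [|y]; [exact: IH | rewrite fE exprD; ring].
Qed.

Lemma upoly_const v c : dpoly (idx v) c -> upoly v 1 c.
Proof.
by move=> vc; exists c, (fun=> 0); split=> // y; rewrite mulr1 addr0.
Qed.

Lemma upoly_mul v d e f g :
  upoly v d f -> upoly v e g -> upoly v (d + e) (fun y => f y * g y).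
Proof.
move=> df; elim: e g => [g g0|e IH g [c [h [vc eh gE]]]].
  by apply: (@upoly_le _ 0) => // y; rewrite g0 mulr0.
have f1 := upoly_le (leqnSn _) (upoly_mulX e (upoly_mulc vc df)).
have f2 := upoly_le (leqnSn _) (IH h eh).
rewrite addnC in f1; rewrite addnS; apply: upoly_ext (upoly_add f1 f2) => y.
by rewrite gE /=; ring.
Qed.

Lemma dpolyS_upoly v f : dpoly (idx v).+1 f -> exists e, upoly v e f.
Proof.
elim=> {f}.
- by move=> f g fg _ [e ef]; exists e; exact: upoly_ext ef.
- by move=> c; exists 1%N; apply/upoly_const/dpoly_const.
- move=> w; rewrite ltnS leq_eqVlt => /predU1P[/idx_inj ->|wv].
    exists 2%N; exists (fun=> 1), (fun=> 0).
    split=> [||y]; [exact: dpoly_const | exact/upoly_const/dpoly_const |].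
    by rewrite mul1r addr0.
  by exists 1%N; exact/upoly_const/dpoly_var.
- move=> f g _ [d df] _ [e eg]; exists (maxn d e).
  by apply: upoly_add; [apply: upoly_le df | apply: upoly_le eg];
    rewrite ?leq_maxl ?leq_maxr.
- by move=> f g _ [d df] _ [e eg]; exists (d + e)%N; exact: upoly_mul.
Qed.

Lemma dpolyS_novar N f : (forall v, idx v != N) -> dpoly N.+1 f -> dpoly N f.
Proof.
move=> novar; elim=> {f}.
- by move=> f g fg _; exact: dpoly_ext.
- by move=> c; exact: dpoly_const.
- move=> v; rewrite ltnS leq_eqVlt (negPf (novar v)) /=.
  exact: dpoly_var.
- by move=> f g _ ? _ ?; exact: dpoly_add.
- by move=> f g _ ? _ ?; exact: dpoly_mul.
Qed.

(** Pseudo-division by c * u^d + g, stated only at the zeros of the divisor, so that no quotient has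
    to be recorded. *)
Lemma upoly_prem v d c g e f :
  dpoly (idx v) c -> upoly v d g -> upoly v e f ->
  exists k r, upoly v d r /\
    forall y, c y * u v y ^+ d + g y = 0 -> c y ^+ k * f y = r y.
Proof.
move=> vc dg; elim: e f => [|e IH] f ef.
  by exists 0%N, f; split=> [|y _]; [exact: upoly_le ef | rewrite mul1r].
have [led|ltd] := leqP e.+1 d.
  by exists 0%N, f; split=> [|y _]; [exact: upoly_le ef | rewrite mul1r].
case: ef => a [h [va eh fE]].
(* At a zero of the divisor this function equals c * f: in c * a * u^e the factor c * u^d is
   replaced by - g. *)
have ef1 : upoly v e (fun y => c y * h y
    + (fun y => - a y) y * (u v y ^+ (e - d) * g y)).
  apply: upoly_add; first exact: upoly_mulc.
  apply: upoly_mulc; first exact: dpoly_opp.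
  by have := upoly_mulX (e - d) dg; rewrite subnK.
have [k [r [dr rE]]] := IH _ ef1.
exists k.+1, r; split=> // y Ay; rewrite -rE // fE exprSr -mulrA; congr (_ * _).
have -> : u v y ^+ e = u v y ^+ (e - d) * u v y ^+ d by rewrite -exprD subnK.
have -> : g y = - (c y * u v y ^+ d) by apply/eqP; rewrite -addr_eq0 addrC Ay.
ring.
Qed.

(** The factor S^e turns each power of [u v] into one of S * u = - h. *)
Lemma upoly_elim v e f S h :
  dpoly (idx v) S -> dpoly (idx v) h -> upoly v e f ->
  exists2 r, dpoly (idx v) r &
    forall y, S y * u v y + h y = 0 -> S y ^+ e * f y = r y.
Proof.
move=> vS vh; elim: e f => [f f0|e IH f [c [g [vc eg fE]]]].
  by exists (fun=> 0) => [|y _]; [exact: dpoly_const | rewrite f0 mulr0].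
have [r vr rE] := IH g eg.
exists (fun y => S y * c y * (- h y) ^+ e + S y * r y) => [|y hy].
  apply: dpoly_add; last exact: dpoly_mul.
  by apply: dpoly_mul; [exact: dpoly_mul | exact/dpoly_exp/dpoly_opp].
have -> : - h y = S y * u v y by apply/eqP; rewrite eq_sym -addr_eq0 hy.
by rewrite -rE // fE exprMn exprS; ring.
Qed.

(** * Derivatives of polynomials and separants *)

Lemma delta0 i : delta i 0 = 0.
Proof. by apply: (addIr (delta i 0)); rewrite -deltaD !add0r. Qed.

Lemma delta1 i : delta i 1 = 0.
Proof.
by apply: (addrI (delta i 1)); rewrite addr0 -[X in _ + X]mul1r
  -[X in X + _]mulr1 -deltaM mulr1.
Qed.

Lemma deltaX i x n : delta i (x ^+ n) = n%:R * x ^+ n.-1 * delta i x.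
Proof.
elim: n => [|[|n] IH]; first by rewrite delta1 !mul0r.
  by rewrite !mul1r.
by rewrite exprS deltaM IH /= exprS [n.+2%:R]mulrS; ring.
Qed.

Lemma delta_monomial v c e i : dpoly (idx v) c ->
  exists2 h, dpoly (idx (s i v)) h &
    forall y, delta i (c y * u v y ^+ e)
      = (e%:R * c y) * u v y ^+ e.-1 * u (s i v) y + h y.
Proof.
move=> vc; exists (fun y => delta i (c y) * u v y ^+ e) => [|y].
  apply: dpoly_mul.
    by apply: dpoly_delta vc => [|w wv]; [exact/ltnW/idx_lt | exact: idx_mono].
  by apply/dpoly_exp/dpoly_var/idx_lt.
by rewrite deltaM deltaX delta_u; ring.
Qed.

(** [S] is the formal derivative of f with respect to [u v], the same for all [i]. The rest comes
    from differentiating coefficients, whose new variables precede [s i v] by [idx_mono]. *)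
Lemma upoly_separant v e f : upoly v e f ->
  exists2 S, upoly v e.-1 S & forall i, exists2 h, dpoly (idx (s i v)) h &
    forall y, delta i (f y) = S y * u (s i v) y + h y.
Proof.
elim: e f => [f f0|e IH f [c [g [vc eg fE]]]].
  exists (fun=> 0) => // i; exists (fun=> 0) => [|y]; first exact: dpoly_const.
  by rewrite f0 delta0 mul0r addr0.
have [S eS SE] := IH g eg.
exists (fun y => (e%:R * c y) * u v y ^+ e.-1 + S y) => [|i].
  (* For e = 0 the leading term is c alone; its factor 0%:R leaves a zero separant. *)
  move: eS; case: (e) => [S0 y|n nS] /=; first by rewrite !mul0r add0r S0.
  exists (fun y => (fun=> n.+1%:R) y * c y), S; split=> //.
  by apply: dpoly_mul => //; exact: dpoly_const.
have [h vh hE] := SE i; have [h' vh' hE'] := delta_monomial e i vc.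
exists (fun y => h y + h' y) => [|y]; first exact: dpoly_add.
by rewrite fE deltaD hE hE'; ring.
Qed.

Lemma idx_shift v i l : (idx v < idx (foldr s v (i :: l)))%N.
Proof.
elim: l i => [|j l IH] i; first exact: idx_lt.
by apply: ltn_trans (idx_lt _ _); exact: IH.
Qed.

(** After the first derivation the relation is linear in its highest derivative, and further
    derivations keep the coefficient [S]: the terms with [delta i (S y)] or [delta i (h y)] only
    involve variables of lower rank. *)
Lemma separant_shift v f S : dpoly (idx v).+1 S ->
  (forall i, exists2 h, dpoly (idx (s i v)) h &
    forall y, delta i (f y) = S y * u (s i v) y + h y) ->
  forall i l, exists2 h, dpoly (idx (foldr s v (i :: l))) h &
    forall y, foldr delta (f y) (i :: l)
      = S y * u (foldr s v (i :: l)) y + h y.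
Proof.
move=> vS SE i l; elim: l i => [|j l IH] i; first exact: SE.
have [h wh hE] := IH j; set w := foldr s v (j :: l) in wh hE *.
have vw : (idx v < idx w)%N by exact: idx_shift.
exists (fun y => delta i (S y) * u w y + delta i (h y)) => [|y].
  apply: dpoly_add; first apply: dpoly_mul.
  - apply: dpoly_delta vS => [|x xv]; first exact: ltn_trans (idx_lt _ _).
    by apply: idx_mono; exact: leq_trans vw.
  - exact/dpoly_var/idx_lt.
  - by apply: dpoly_delta wh => [|x xw]; [exact/ltnW/idx_lt | exact: idx_mono].
rewrite -[foldr delta _ _]/(delta i (foldr delta (f y) (j :: l))) hE.
by rewrite deltaD deltaM delta_u -/w /=; ring.
Qed.

Definition differential_polynomial f : Prop := exists N, dpoly N f.

Lemma differential_polynomial_const c : differential_polynomial (fun=> c).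
Proof. by exists 0%N; exact: dpoly_const. Qed.

Lemma differential_polynomial_var v : differential_polynomial (u v).
Proof. by exists (idx v).+1; exact: dpoly_var. Qed.

Lemma differential_polynomial_add f g :
  differential_polynomial f -> differential_polynomial g ->
  differential_polynomial (fun y => f y + g y).
Proof.
move=> [M Mf] [N Ng]; exists (maxn M N).
by apply: dpoly_add; [apply: dpoly_le Mf | apply: dpoly_le Ng];
  rewrite ?leq_maxl ?leq_maxr.
Qed.

Lemma differential_polynomial_mul f g :
  differential_polynomial f -> differential_polynomial g ->
  differential_polynomial (fun y => f y * g y).
Proof.
move=> [M Mf] [N Ng]; exists (maxn M N).
by apply: dpoly_mul; [apply: dpoly_le Mf | apply: dpoly_le Ng];
  rewrite ?leq_maxl ?leq_maxr.
Qed.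

Lemma differential_polynomial_ext f g : f =1 g ->
  differential_polynomial f -> differential_polynomial g.
Proof. by move=> fg [N Nf]; exists N; exact: dpoly_ext Nf. Qed.

Lemma differential_polynomial_delta i f :
  differential_polynomial f -> differential_polynomial (fun y => delta i (f y)).
Proof.
move=> [N]; elim=> {f}.
- by move=> f g fg _; apply: differential_polynomial_ext => y; rewrite fg.
- by move=> c; exact: (differential_polynomial_const (delta i c)).
- move=> v _; apply: differential_polynomial_ext
    (differential_polynomial_var (s i v)) => y.
  by rewrite delta_u.
- move=> f g _ IHf _ IHg.
  apply: differential_polynomial_ext (differential_polynomial_add IHf IHg) => y.
  by rewrite deltaD.
- move=> f g Nf IHf Ng IHg; apply: differential_polynomial_ext
    (differential_polynomial_add
      (differential_polynomial_mul IHf (ex_intro _ N Ng))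
      (differential_polynomial_mul (ex_intro _ N Nf) IHg)) => y.
  by rewrite deltaM.
Qed.

Hypothesis dickson : forall E : V -> Prop, exists2 L : seq V,
  forall v, v \in L -> E v &
  forall v, E v -> exists2 w, w \in L & exists l, v = foldr s w l.

(** * The generic point of an ultrafilter and its specializations *)

Section Ultrafilter.

Variable U : set_system Y.
Hypothesis UU : UltraFilter U.

(** The class of f in the ultrapower of [P] along [U] is zero. *)
Definition vanishes (f : Y -> P) : Prop := U [set y | f y = 0]%classic.

Lemma vanishes_impl f g :
  (forall y, f y = 0 -> g y = 0) -> vanishes f -> vanishes g.
Proof. by move=> fg; apply: filterS. Qed.

Lemma vanishes_impl2 f g h : (forall y, f y = 0 -> g y = 0 -> h y = 0) ->
  vanishes f -> vanishes g -> vanishes h.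
Proof.
move=> fgh Zf Zg; apply: filterS (filterI Zf Zg) => y [/= ? ?].
exact: fgh.
Qed.

Lemma vanishesN f : ~ vanishes f -> U [set y | f y != 0]%classic.
Proof.
move=> nZ; have [//|] := in_ultra_setVsetC [set y | f y = 0]%classic UU.
by apply: filterS => y /= /eqP.
Qed.

(* [leader_at v d]: in the ultraproduct, [u v] has a relation of degree [d] over
   the preceding variables. *)
Definition leader_at v d : Prop := exists c g,
  [/\ dpoly (idx v) c, upoly v d g, ~ vanishes c
    & vanishes (fun y => c y * u v y ^+ d + g y)].

Definition leader v : Prop := exists d, leader_at v d.

(** This is the step at [v] of the induction on the highest derivative. *)
Definition specializes y v : Prop := forall e f, upoly v e f -> vanishes f ->
  (forall c, dpoly (idx v) c -> vanishes c -> c y = 0) -> f y = 0.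

(** A leading coefficient that did not vanish generically would give a relation of degree below [d];
    so the coefficients can be peeled off one by one. *)
Lemma vanishes_reduced v d y : (forall e, (e < d)%N -> ~ leader_at v e) ->
  (forall c, dpoly (idx v) c -> vanishes c -> c y = 0) ->
  forall e f, (e <= d)%N -> upoly v e f -> vanishes f -> f y = 0.
Proof.
move=> nolead Zy; elim=> [f _ f0 _|e IH f ed [c [g [vc eg fE]]] Zf].
  exact: f0.
have Zc : vanishes c.
  apply: contrapT => nZc; apply: (nolead e ed); exists c, g; split=> //.
  by apply: vanishes_impl Zf => z; rewrite fE.
have Zg : vanishes g.
  apply: vanishes_impl2 Zc Zf => z cz; rewrite fE cz mul0r add0r.
  by [].
by rewrite fE (Zy c) // mul0r add0r IH // ltnW.
Qed.

Lemma nonleader_specializes v y : ~ leader v -> specializes y v.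
Proof.
move=> nl e f ef Zf Zy; apply: (@vanishes_reduced v e y) ef Zf => // d _ ld.
by apply: nl; exists d.
Qed.

(** [W] requires a relation [A] of minimal degree to hold, with initial [c] and separant [S]
    nonzero. One [W] serves all derivatives of [v], since every proper derivative of [A] has [S] as
    coefficient of its highest variable. *)
Lemma leader_specializes v : leader v ->
  exists2 W, U W & forall y, W y -> forall l, specializes y (foldr s v l).
Proof.
move=> lv; have exd : exists d, `[< leader_at v d >].
  by case: lv => d ld; exists d; exact/asboolP.
case: (ex_minnP exd) => d ld dmin; have /asboolP[c [g [vc dg nZc ZA]]] := ld.
have nolead e : (e < d)%N -> ~ leader_at v e.
  by move=> ed le; move: ed; rewrite ltnNge dmin //; exact/asboolP.
clear ld; case: d => [|d] in dg ZA dmin nolead *.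
  (* A relation of degree 0 would say that [c] itself vanishes generically. *)
  case: nZc; apply: vanishes_impl ZA => y.
  by rewrite dg addr0 mulr1.
pose A y := c y * u v y ^+ d.+1 + g y.
have [S' dS' SE'] := upoly_separant dg.
pose S y := (d.+1%:R * c y) * u v y ^+ d + S' y.
have vdc : dpoly (idx v) (fun y => d.+1%:R * c y).
  by apply: (@dpoly_mul _ (fun=> d.+1%:R)) => //; exact: dpoly_const.
(* Otherwise [S] would be a relation of smaller degree; its initial d.+1 * c is generically nonzero
   in characteristic 0. *)
have nZS : ~ vanishes S.
  move=> ZS; apply: (nolead d (ltnSn d)).
  exists (fun y => d.+1%:R * c y), S'; split=> // Zdc.
  apply: nZc; apply: vanishes_impl Zdc => y /eqP.
  by rewrite mulf_eq0 (negPf (pchar0 d)) => /eqP.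
have vS : dpoly (idx v).+1 S.
  by apply: (@upoly_dpoly v d.+1); exists (fun y => d.+1%:R * c y), S'.
have SE i : exists2 h, dpoly (idx (s i v)) h &
    forall y, delta i (A y) = S y * u (s i v) y + h y.
  have [h vh hE] := SE' i; have [h' vh' hE'] := delta_monomial d.+1 i vc.
  exists (fun y => h y + h' y) => [|y]; first exact: dpoly_add.
  by rewrite /A deltaD hE hE' /S /=; ring.
exists [set y | A y = 0 /\ (c y != 0 /\ S y != 0)]%classic.
  apply: filterI ZA _; apply: filterI; exact: vanishesN.
move=> y [Ay [cy Sy]] [|i l] e f ef Zf Zy.
  (* The case of [v] itself: the remainder is reduced, so it vanishes at y, and [c] cancels. *)
  have [k [r [dr rE]]] := upoly_prem vc dg ef.
  have Zr : vanishes r.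
    by apply: vanishes_impl2 ZA Zf => z Az fz; rewrite -rE // fz mulr0.
  have /eqP := rE y Ay.
  rewrite (vanishes_reduced nolead Zy (leqnn _) dr Zr) mulf_eq0.
  by rewrite expf_eq0 (negPf cy) andbF => /eqP.
have [h wh hE] := separant_shift vS SE i l.
set w := foldr s v (i :: l) in ef Zy wh hE *.
have wS : dpoly (idx w) S by apply: dpoly_le vS; exact: idx_shift.
(* A z = 0 is an equality in [P], so all iterated derivatives of A z are zero as well. *)
have A0 z : A z = 0 -> S z * u w z + h z = 0.
  move=> Az; rewrite -hE Az; elim: (i :: l) => //= j l' ->.
  exact: delta0.
have [r wr rE] := upoly_elim wS wh ef.
have Zr : vanishes r.
  by apply: vanishes_impl2 ZA Zf => z /A0 Az fz; rewrite -rE // fz mulr0.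
have /eqP := rE y (A0 y Ay).
by rewrite (Zy r) // mulf_eq0 expf_eq0 (negPf Sy) andbF => /eqP.
Qed.

Lemma generic_specialization : exists2 W, U W &
  forall y, W y -> forall f, differential_polynomial f -> vanishes f -> f y = 0.
Proof.
have [L Llead Ldom] := dickson leader.
have [W UW Wspec] : exists2 W, U W & forall y, W y ->
    forall w, w \in L -> forall l, specializes y (foldr s w l).
  elim: L Llead {Ldom} => [_|w L IH Llead].
    by exists setT%classic => //; exact: filterT.
  have [|W1 UW1 W1P] := IH.
    by move=> v vL; apply: Llead; rewrite in_cons vL orbT.
  have [|W2 UW2 W2P] := @leader_specializes w.
    by apply: Llead; rewrite in_cons eqxx.
  exists (W1 `&` W2)%classic => [|y [W1y W2y] v]; first exact: filterI.
  by rewrite in_cons => /predU1P[->|]; [exact: W2P | exact: W1P].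
exists W => // y Wy f [N]; elim: N f => [f /dpoly0 [c fc] Zf|N IH f Nf Zf].
  (* Sets of the ultrafilter are nonempty, so a generically vanishing constant is 0. *)
  by have [z] := filter_ex Zf; rewrite /= !fc.
have [[v vN]|nov] := pselect (exists v, idx v = N).
  rewrite -vN in IH Nf; have [e ef] := dpolyS_upoly Nf.
  have spec : specializes y v.
    have [lv|nlv] := pselect (leader v); last exact: nonleader_specializes.
    by have [w wL [l ->]] := Ldom v lv; exact: Wspec.
  exact: spec ef Zf IH.
apply: IH => //; apply: dpolyS_novar Nf => v.
by apply/eqP => vN; apply: nov; exists v.
Qed.

End Ultrafilter.

(** Equivalently, [C] is the common zero set of the differential polynomials vanishing on it. *)
Definition separated (C : Y -> Prop) : Prop := forall y, ~ C y ->
  exists f, [/\ differential_polynomial f, forall z, C z -> f z = 0 & f y != 0].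

Lemma separated_noetherian (C : nat -> Y -> Prop) :
  (forall n, separated (C n)) -> (forall n y, C n.+1 y -> C n y) ->
  exists N, forall n, (N <= n)%N -> forall y, C n y <-> C N y.
Proof.
move=> Csep Cdec; apply: contrapT => nostab.
have Cle M N y : (M <= N)%N -> C N y -> C M y.
  move=> /subnKC <-; elim: (N - M)%N => [|n IH]; first by rewrite addn0.
  by rewrite addnS => /Cdec.
(* The triple [t] holds an index n, a point of C N outside C n, and a polynomial vanishing on C n
   but not at that point. *)
have step N : exists t : nat * Y * (Y -> P), [/\ differential_polynomial t.2,
    C N t.1.2, forall z, C t.1.1 z -> t.2 z = 0 & t.2 t.1.2 != 0].
  apply: contrapT => none; apply: nostab; exists N => n leNn y.
  split=> [|CNy]; first exact: Cle.
  apply: contrapT => nCy; have [f [df fC fy]] := Csep n y nCy.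
  by apply: none; exists (n, y, f).
have [t tP] := choice step.
pose a n := (t n).1.2.
have [U [UU aU]] := ultraFilterLemma (fmap_proper_filter a eventually_filter).
have Ua n : U (fun y => exists2 i, (n <= i)%N & y = a i).
  by apply: aU; exists n => // i /= ni; exists i.
have [W UW WP] := generic_specialization UU.
(* Some a n lies in [W]. Its polynomial vanishes on a tail of the sequence, hence generically, hence
   at a n: a contradiction. *)
have [y [Wy [n _ yE]]] := filter_ex (filterI UW (Ua 0%N)).
have [dtn _ tn0 /eqP tny] := tP n.
apply: tny; rewrite -/(a n) -yE; apply: WP => //.
apply: filterS (Ua (t n).1.1) => _ [i ni ->] /=.
by apply/tn0/(Cle _ _ _ ni); case: (tP i).
Qed.

End DifferentialPolynomials.

(** * Dickson's lemma and a ranking of the derivatives *)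

Section Dickson.
Local Open Scope nat_scope.

Variable V : eqType.

Definition dominates (cs : seq (V -> nat)) (L : seq V) (E : V -> Prop) : Prop :=
  (forall v, v \in L -> E v) /\
  forall v, E v -> exists2 w, w \in L & all (fun c : V -> nat => c w <= c v) cs.

(** [L0] settles the other coordinates, hence every v with c v at least the maximum [M] of c on
    [L0]; the finitely many slices c v = h with h < M are settled by induction. *)
Lemma dickson_coordinates (cs : seq (V -> nat)) (E : V -> Prop) :
  exists L, dominates cs L E.
Proof.
elim: cs E => [|c cs IH] E.
  have [[v Ev]|none] := pselect (exists v, E v); last first.
    by exists [::]; split=> // v Ev; case: none; exists v.
  exists [:: v]; split=> [w|w _]; first by rewrite inE => /eqP ->.
  by exists v; rewrite ?mem_head.
have [L0 [L0E L0P]] := IH E.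
pose M := \max_(w <- L0) c w.
have [L1 [L1E L1P]] : exists L1 : seq V, (forall v, v \in L1 -> E v) /\
    forall v, E v -> c v < M ->
      exists2 w, w \in L1 & all (fun c : V -> nat => c w <= c v) (c :: cs).
  elim: M => [|h [L [LE LP]]]; first by exists [::].
  have [L' [L'E L'P]] := IH (fun v => E v /\ c v = h).
  exists (L ++ L'); split=> [v|v Ev].
    by rewrite mem_cat => /orP[/LE|/L'E[]].
  rewrite ltnS leq_eqVlt => /predU1P[cv|/(LP v Ev)[w wL wv]]; last first.
    by exists w; rewrite // mem_cat wL.
  have [w wL' wv] := L'P v (conj Ev cv).
  exists w; rewrite ?mem_cat ?wL' ?orbT //=.
  by rewrite wv cv; case: (L'E w wL') => _ ->; rewrite leqnn.
exists (L0 ++ L1); split=> [v|v Ev].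
  by rewrite mem_cat => /orP[/L0E|/L1E].
have [/(L1P v Ev)[w wL wv]|Mv] := ltnP (c v) M.
  by exists w; rewrite // mem_cat wL orbT.
have [w wL wv] := L0P v Ev; exists w; rewrite ?mem_cat ?wL //= wv andbT.
by apply: leq_trans Mv; exact: leq_bigmax_seq.
Qed.

End Dickson.

Section Ranking.
Local Open Scope nat_scope.

(* The derivative [m] of the [j]-th component is ranked by [k * w + j], where
   [w] is the product of the [p_i ^ m i] over distinct primes [p_i]: unique
   factorization makes this injective, and differentiating with respect to the
   [i]-th variable multiplies [w] by [p_i]. *)

(** An increasing sequence of primes that may skip some; the iteration count i.+1 makes the term at
    0 prime too. *)
Definition nth_prime i : nat := iter i.+1 (fun p => s2val (prime_above p)) 0.

Lemma prime_nth_prime i : prime (nth_prime i).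
Proof. by rewrite /nth_prime /=; case: prime_above. Qed.

Lemma nth_prime_inj : injective nth_prime.
Proof.
have lt : {homo nth_prime : i j / i < j}.
  apply: homo_ltn => [j i k|i]; first exact: ltn_trans.
  by rewrite [nth_prime i.+1]/nth_prime iterS; case: prime_above.
by move=> i j eq_p; case: (ltngtP i j) => // /lt; rewrite eq_p ltnn.
Qed.

Variables n k : nat.

Definition weight (m : 'X_{1..n}) : nat := \prod_(i < n) nth_prime i ^ m i.

Lemma weight_gt0 m : 0 < weight m.
Proof.
by apply: prodn_gt0 => i; rewrite expn_gt0 prime_gt0 // prime_nth_prime.
Qed.

Lemma weightDU m i : weight (m + U_(i))%MM = weight m * nth_prime i.
Proof.
rewrite /weight (eq_bigr (fun j : 'I_n =>
  nth_prime j ^ m j * nth_prime j ^ (i == j))) => [|j _]; last first.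
  by rewrite mnmDE mnm1E expnD.
rewrite big_split /=; congr (_ * _); rewrite (bigD1 i) //= eqxx expn1.
by rewrite big1 ?muln1 // => j; rewrite eq_sym => /negPf ->.
Qed.

Lemma logn_weight m (i : 'I_n) : logn (nth_prime i) (weight m) = m i.
Proof.
have logE (r : seq 'I_n) : logn (nth_prime i) (\prod_(j <- r) nth_prime j ^ m j)
    = \sum_(j <- r) m j * (i == j).
  elim: r => [|j r IH]; first by rewrite !big_nil logn1.
  rewrite !big_cons lognM ?IH.
  - by rewrite lognX logn_prime ?prime_nth_prime // (inj_eq nth_prime_inj).
  - by rewrite expn_gt0 prime_gt0 // prime_nth_prime.
  - by apply: prodn_gt0 => l; rewrite expn_gt0 prime_gt0 // prime_nth_prime.
rewrite /weight logE (bigD1 i) //= eqxx muln1 big1 ?addn0 // => j.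
by rewrite eq_sym => /negPf ->; rewrite muln0.
Qed.

Lemma weight_inj : injective weight.
Proof.
by move=> m m' eq_w; apply/mnmP => i; rewrite -!logn_weight eq_w.
Qed.

Definition rank (v : 'X_{1..n} * 'I_k) : nat := k * weight v.1 + v.2.

(** As [v.2 < k], comparing ranks is lexicographic in weight and component. *)
Lemma rank_lt v w : (rank v < rank w) =
  (weight v.1 < weight w.1) || (weight v.1 == weight w.1) && (v.2 < w.2).
Proof.
have lt_rank (x y : 'X_{1..n} * 'I_k) :
    weight x.1 < weight y.1 -> rank x < rank y.
  move=> xy; apply: leq_trans (_ : k * (weight x.1).+1 <= _).
    by rewrite /rank mulnS [ltnRHS]addnC ltn_add2l.
  by apply: leq_trans (leq_addr _ _); rewrite leq_mul2l xy orbT.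
case: (ltngtP (weight v.1) (weight w.1)) => [vw|wv|vw] /=; first exact: lt_rank.
  by apply/negbTE; rewrite -leqNgt ltnW // lt_rank.
by rewrite /rank vw ltn_add2l.
Qed.

Lemma rank_inj : injective rank.
Proof.
move=> v w eq_r; have := rank_lt v w; have := rank_lt w v.
rewrite eq_r !ltnn.
case: (ltngtP (weight v.1) (weight w.1)) => //= /weight_inj.
by case: v w {eq_r} => [m i] [m' j] /= ->; case: ltngtP => // /val_inj ->.
Qed.

Definition shift i (v : 'X_{1..n} * 'I_k) : 'X_{1..n} * 'I_k :=
  ((v.1 + U_(i))%MM, v.2).

Lemma rank_shift_lt i v : rank v < rank (shift i v).
Proof.
rewrite rank_lt /= weightDU -[X in X < _]muln1 ltn_pmul2l ?weight_gt0 //.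
by rewrite prime_gt1 // prime_nth_prime.
Qed.

Lemma rank_shift_mono i v w :
  rank v < rank w -> rank (shift i v) < rank (shift i w).
Proof.
have p0 : 0 < nth_prime i by rewrite prime_gt0 // prime_nth_prime.
by rewrite !rank_lt /= !weightDU ltn_pmul2r // eqn_pmul2r.
Qed.

Lemma foldr_shift m m' j : exists l, ((m + m')%MM, j) = foldr shift (m, j) l.
Proof.
move: {2}(mdeg m') (erefl (mdeg m')) => d; elim: d m' => [|d IH] m' dm'.
  exists [::]; move/eqP: dm'; rewrite mdeg_eq0 => /eqP -> /=.
  by congr (_, _); apply/mnmP => i; rewrite mnmDE mnm0E addn0.
have [i m'i] : exists i, m' i != 0.
  apply: contrapT => m'0; move: dm'; rewrite mdegE big1 // => i _.
  by apply/eqP; apply: contrapT => m'i; apply: m'0; exists i; apply/negP.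
have m'E : (m' - U_(i) + U_(i))%MM = m' by rewrite submK // lep1mP.
have [|l lE] := IH (m' - U_(i))%MM.
  by move: dm'; rewrite -{1}m'E mdegD mdeg1 addn1 => -[].
exists (i :: l); rewrite /= -lE /shift /=; congr (_, _).
by rewrite -addmA m'E.
Qed.

Lemma dickson_shift (E : 'X_{1..n} * 'I_k -> Prop) :
  exists2 L : seq ('X_{1..n} * 'I_k), forall v, v \in L -> E v &
    forall v, E v -> exists2 w, w \in L & exists l, v = foldr shift w l.
Proof.
(* Using both [v.2] and [k - v.2] forces domination to preserve the component. *)
pose cs :=
  [:: fun v : 'X_{1..n} * 'I_k => val v.2, fun v : 'X_{1..n} * 'I_k => k - v.2
    & [seq (fun v : 'X_{1..n} * 'I_k => v.1 i) | i <- enum 'I_n]].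
have [L [LE LP]] := dickson_coordinates cs E.
exists L => // v /LP [w wL] /and3P[wv2 vw2 /allP wv1]; exists w => //.
have eq2 : w.2 = v.2.
  apply/val_inj/eqP; rewrite eqn_leq wv2 /=.
  by move: vw2; rewrite leq_sub2lE // ltnW.
have le1 : (w.1 <= v.1)%MM.
  apply/mnm_lepP => i; apply: (wv1 (fun v => v.1 i)).
  by apply: map_f; rewrite mem_enum.
have [l lE] := foldr_shift w.1 (v.1 - w.1)%MM v.2.
exists l; move: lE; rewrite addmC submK // -eq2.
by case: w {wL wv2 vw2 wv1 le1} eq2 => m j /= ->; case: v.
Qed.

End Ranking.

(** * Poisson polynomials are differential polynomials *)

Section Jets.

Variables (R : idomainType) (iota : {rmorphism rat -> R}) (m k : nat).

Notation P := {mpoly R[m.*2]}.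
Notation X := {ffun 'I_k -> symplectic m R}.

Definition jet (v : 'X_{1..m.*2} * 'I_k) (a : X) : P := (a v.2 : P)^`M[v.1].

Definition jet_polynomial : (X -> P) -> Prop :=
  differential_polynomial (@rank m.*2 k) jet.

Lemma mderiv_jet i v a : (jet v a)^`M(i) = jet (shift i v) a.
Proof. by rewrite /jet /= mderivmDm mderivmU1m. Qed.

(** The embedding of the rationals enters here: a ring morphism from a field is injective. *)
Lemma mpoly_pchar0 n : n.+1%:R != 0 :> P.
Proof.
rewrite -mpolyC_nat mpolyC_eq0 -(rmorph_nat iota) fmorph_eq0.
by rewrite Num.Theory.pnatr_eq0.
Qed.

Lemma jet_polynomial_noetherian (C : nat -> X -> Prop) :
  (forall n, separated (@rank m.*2 k) jet (C n)) ->
  (forall n x, C n.+1 x -> C n x) ->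
  exists N, forall n, (N <= n)%N -> forall x, C n x <-> C N x.
Proof.
apply: (@separated_noetherian P 'I_(m.*2) _ _ (@mderiv _ _) _ (@shift _ _)).
- exact: mpoly_pchar0.
- exact: mderivD.
- exact: mderivM.
- exact: rank_inj.
- exact: rank_shift_lt.
- exact: rank_shift_mono.
- exact: mderiv_jet.
- exact: dickson_shift.
Qed.

Lemma jet_polynomial_sub f g : jet_polynomial f -> jet_polynomial g ->
  jet_polynomial (fun a => f a - g a).
Proof.
move=> df dg; apply: differential_polynomial_ext (differential_polynomial_add df
  (differential_polynomial_mul (differential_polynomial_const _ _ (-1)) dg)) => a.
by rewrite mulN1r.
Qed.

Lemma jet_polynomial_br f g : jet_polynomial f -> jet_polynomial g ->
  jet_polynomial (fun a => sympl_bracket (f a) (g a)).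
Proof.
have dD i h : jet_polynomial h -> jet_polynomial (fun a => (h a)^`M(i)).
  exact: (differential_polynomial_delta (@mderivD _ _) (@mderivM _ _) mderiv_jet).
move=> df dg; rewrite /sympl_bracket; elim: (index_enum _) => [|i r IH].
  apply: differential_polynomial_ext (differential_polynomial_const _ _ 0) => a.
  by rewrite big_nil.
apply: differential_polynomial_ext (differential_polynomial_add _ IH) => [a|].
  by rewrite big_cons.
by apply: jet_polynomial_sub; apply: differential_polynomial_mul; exact: dD.
Qed.

Variables (F D : poissonAlgType R) (z : 'I_k -> F).
Variables (iA : symplectic m R -> D) (iF : F -> D).

(** One f serves all points: elements of the algebra become constants, generators jets of order 0,
    and jet polynomials are closed under the operations. *)
Lemma evaluation_jet_polynomial d :
  generated (fun e => (exists x, e = iA x) \/ exists i, e = iF (z i)) d ->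
  exists2 f, jet_polynomial f &
    forall a phi, is_evaluation z iA iF a phi -> phi d = f a.
Proof.
elim=> {d}.
- move=> _ [[x ->]|[i ->]].
    exists (fun=> x) => [|a phi [_ -> //]]; exact: differential_polynomial_const.
  exists (jet (0%MM, i)); first exact: differential_polynomial_var.
  by move=> a phi [_ _ ->]; rewrite /jet mderivm0m.
- exists (fun=> 1) => [|a phi [[_ [phi1 _] _] _ _]]; last exact: phi1.
  exact: differential_polynomial_const.
- move=> c d e _ [f df fE] _ [g dg gE].
  exists (fun a => c%:MP * f a + g a) => [|a phi ev].
    apply: differential_polynomial_add => //.
    apply: differential_polynomial_mul => //.
    exact: (differential_polynomial_const _ _ c%:MP).
  case: (ev) => [[phiL _ _] _ _].
  by rewrite phiL (fE a) // (gE a) // mul_mpolyC.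
- move=> d e _ [f df fE] _ [g dg gE].
  exists (fun a => f a * g a) => [|a phi ev].
    exact: differential_polynomial_mul.
  case: (ev) => [[_ [_ phiM] _] _ _].
  by rewrite phiM (fE a) // (gE a).
- move=> d e _ [f df fE] _ [g dg gE].
  exists (fun a => sympl_bracket (f a) (g a)) => [|a phi ev].
    exact: jet_polynomial_br.
  case: (ev) => [[_ _ phiB] _ _].
  by rewrite phiB (fE a) // (gE a).
Qed.

(** Separation passes to unions by multiplying polynomials, [P] being a domain, and to arbitrary
    intersections by using a single member that misses the point. *)
Lemma zariski_closed_separated M C :
  in_variety M (symplectic m R : poissonAlgType R) -> is_free M z ->
  is_coproduct M iA iF -> zariski_closed z iA iF C ->
  separated (@rank m.*2 k) jet C.
Proof.
move=> MA Fz cD; elim=> {C}.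
- move=> _ [S ->] a nZa; have [phi ev] := evaluation_exists MA Fz cD a.
  have [d [Sd phid]] : exists d, S d /\ phi d <> 0.
    apply: contrapT => none; apply: nZa; exists phi => // d Sd.
    by apply: contrapT => phid; apply: none; exists d.
  have [f df fE] := evaluation_jet_polynomial (coproduct_generated Fz cD d).
  exists f; split=> // [b [psi evb Spsi]|]; first by rewrite -(fE b psi) ?Spsi.
  by rewrite -(fE a phi) //; apply/eqP.
- move=> a _; exists (fun=> 1); split=> //; last exact: oner_neq0.
  exact: differential_polynomial_const.
- move=> C1 C2 _ sep1 _ sep2 a /not_orP[].
  move=> /sep1 [f [df f0 fa]] /sep2 [g [dg g0 ga]].
  exists (fun b => f b * g b); split; first exact: differential_polynomial_mul.
    by move=> b [/f0 ->|/g0 ->]; rewrite ?mul0r ?mulr0.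
  by rewrite mulf_neq0.
- move=> G _ sepG a nGa.
  have [C [GC nCa]] : exists C, G C /\ ~ C a.
    apply: contrapT => none; apply: nGa => C GC.
    by apply: contrapT => nCa; apply: none; exists C.
  have [f [df f0 fa]] := sepG C GC a nCa.
  by exists f; split=> // b Gb; apply: f0; exact: Gb.
- move=> C1 C2 C12 _ sep1 a nC2; have [|f [df f0 fa]] := sep1 a.
    by move/C12.
  by exists f; split=> // b /C12; exact: f0.
Qed.

End Jets.

Theorem theorem6 (R : idomainType) (iota : {rmorphism rat -> R})
    (hR : radically_noetherian R) (m : nat) (hm : (0 < m)%N) :
  equationally_noetherian (symplectic m R).
Proof.
move=> M MA k _ F z Fz D iA iF cD _ _ C Ccl Cdec.
apply: (jet_polynomial_noetherian iota) Cdec => n.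
exact: zariski_closed_separated MA Fz cD (Ccl n).
Qed.
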